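(* There is a constant $C$ such that for every even integer $n\geq 10$ there exists a latin square $L$ of order $n$ satisfying $n^2>\tau(L)\geq \tfrac{19}{36}n^2 - Cn$. (In the paper's notation: $n^2>\tau(L)\ge 19n^2/36+O(n)$.)
   Context: A latin square of order $n$ is an $n\times n$ array on $n$ symbols in which each symbol occurs exactly once in each row and each column; it is viewed as the set of $n^2$ entries $(r,c,s)$ (symbol $s$ in row $r$, column $c$). A transversal is a set of $n$ entries containing each row, each column and each symbol exactly once. An entry is transversal-free if it lies in no transversal, and $\tau(L)$ denotes the number of transversal-free entries of $L$ (so $\tau(L)<n^2$ means $L$ has at least one transversal). *)

(* Defs.v *)
From mathcomp Require Import all_boot all_order.
From mathcomp Require Import all_fingroup.
Set Implicit Arguments. Unset Strict Implicit. Unset Printing Implicit Defensive.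

Definition is_latin_square (n : nat) (L : 'I_n -> 'I_n -> 'I_n) : Prop :=
  (forall r, injective (L r)) /\ (forall c, injective (fun r => L r c)).

(* A transversal is a set of n entries, one in each row, each column and with
   each symbol once; it is given by the permutation s (row r -> column s r)
   such that the symbols r |-> L r (s r) are pairwise distinct. *)
Definition is_transversal (n : nat) (L : 'I_n -> 'I_n -> 'I_n) (s : {perm 'I_n}) : bool :=
  injectiveb (fun r => L r (s r)).

Definition in_transversal (n : nat) (L : 'I_n -> 'I_n -> 'I_n) (r c : 'I_n) : bool :=
  [exists s : {perm 'I_n}, is_transversal L s && (s r == c)].

Definition tau (n : nat) (L : 'I_n -> 'I_n -> 'I_n) : nat :=
  #|[set rc : 'I_n * 'I_n | ~~ in_transversal L rc.1 rc.2]|.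

(* Main.v *)
(* Start from Z_n, where row r has r + c in column c, and change some rows so
   that column c of row r contains c + l(r, c).  Along a transversal the values
   l(r, c) sum to 0 modulo n.  The maxima of the rows of l sum to 0 modulo n as
   well, and the maxima minus the minima sum to n - 1, so a transversal takes the maximum
   in every row.

   About n/2 rows are changed, in n/6 slabs of three rows a, a+1, a+2.  In each
   column l permutes the three labels of the slab, and the maximum of each of
   its rows is a + 2.  The middle row attains it in a single cell, which is
   therefore in all transversals; this excludes the other cells of n/6 rows, of
   n/6 columns and of n/6 symbols.  The outer two rows attain the maximum in
   complementary sets of columns, so the cells left over inject by (l(r, c), c)
   into the cells of 2n/3 rows of Z_n that avoid n/6 columns and n/6 symbols, of
   which there are at most (2n/3)(2n/3) + (n/6)^2 = (17/36) n^2. *)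

Require Import Defs.
From mathcomp Require Import all_boot all_order all_fingroup.
From mathcomp Require Import zify.
Set Implicit Arguments. Unset Strict Implicit. Unset Printing Implicit Defensive.


(** * Arithmetic modulo 3 and modulo [n] *)

Lemma lt3 x : x %% 3 < 3.
Proof. exact: ltn_pmod. Qed.

Lemma mod3P (x : nat) : [\/ x %% 3 = 0, x %% 3 = 1 | x %% 3 = 2].
Proof. have := ltn_mod x 3; case: (x %% 3) => [|[|[|]]] // _; by constructor. Qed.

Lemma modn_small_inj (n x y : nat) : x < n + n -> y < n + n -> x = y %[mod n] ->
  [\/ x = y, x = y + n | y = x + n].
Proof.
move=> hx hy.
have E z : z < n + n -> z %% n = if z < n then z else z - n.
  move=> hz; case: ltnP => hzn; first by rewrite modn_small.
  by rewrite -{1}(subnK hzn) modnDr modn_small //; lia.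
rewrite !E //; case: ltnP => ?; case: ltnP => ? H.
- by constructor 1.
- by constructor 3; lia.
- by constructor 2; lia.
- by constructor 1; lia.
Qed.

Lemma nth3_inj (u v w i j : nat) : i < 3 -> j < 3 ->
  nth 0 [:: u; v; w] i = nth 0 [:: u; v; w] j -> uniq [:: u; v; w] -> i = j.
Proof. by move=> hi hj + un; move=> /eqP; rewrite nth_uniq // => /eqP. Qed.

Lemma split3 m g r : m <= r < m + 3 * g -> exists j i : nat,
  [/\ j < g, i < 3, r = m + 3 * j + i & (r - m) %% 3 = i].
Proof.
move=> hr; exists ((r - m) %/ 3), ((r - m) %% 3).
by split=> //; [lia | exact: lt3 | lia].
Qed.

Lemma all_iotaP (P : nat -> bool) m l : all P (iota m l) -> forall p, m <= p < m + l -> P p.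
Proof. by move=> /allP H p hp; apply: H; rewrite mem_iota. Qed.

(** * Transversals and slack *)

(* The Delta lemma: summing over a transversal, the slacks [lam r - lb r (s r)]
   add up to a multiple of [n], and their sum is smaller than [n]. *)
Lemma transversal_tight n (L : 'I_n -> 'I_n -> 'I_n) (lb : 'I_n -> 'I_n -> nat)
    (lam w : 'I_n -> nat) (s : {perm 'I_n}) :
  (forall r c, L r c = c + lb r c %[mod n]) ->
  (forall r c, lb r c <= lam r <= lb r c + w r) ->
  n %| \sum_r lam r -> \sum_r w r < n ->
  Defs.is_transversal L s -> forall r, lb r (s r) = lam r.
Proof.
move=> LE bnd dlam wn /injectiveP inj.
have E1 : \sum_r L r (s r) = \sum_(x < n) x.
  by rewrite [RHS](reindex_inj inj).
have E2 : \sum_r s r = \sum_(x < n) x.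
  by rewrite [RHS](reindex_inj (@perm_inj _ s)).
(* Symbols and columns have the same sum, so the labels sum to 0 modulo [n]. *)
have dlb : n %| \sum_r lb r (s r).
  have : \sum_r L r (s r) = \sum_r (s r + lb r (s r)) %[mod n].
    by rewrite -modn_summ -[RHS]modn_summ; under eq_bigr do rewrite LE.
  rewrite E1 big_split /= E2 -{1}[\sum_(x < n) x]addn0 => /eqP.
  by rewrite eqn_modDl mod0n eq_sym.
have E3 : \sum_r lam r = \sum_r lb r (s r) + \sum_r (lam r - lb r (s r)).
  rewrite -big_split /=; apply: eq_bigr => r _.
  by rewrite subnKC //; case/andP: (bnd r (s r)).
have : n %| \sum_r (lam r - lb r (s r)) by move: dlam; rewrite E3 dvdn_addr.
have lt : \sum_r (lam r - lb r (s r)) < n.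
  apply: leq_ltn_trans wn; apply: leq_sum => r _.
  by rewrite leq_subLR; case/andP: (bnd r (s r)).
move=> d0 r.
have : \sum_r (lam r - lb r (s r)) == 0.
  by move: d0; rewrite /dvdn modn_small.
rewrite sum_nat_eq0 => /forallP /(_ r) /=; rewrite subn_eq0 => le.
by apply/eqP; rewrite eqn_leq le andbT; case/andP: (bnd r (s r)).
Qed.

Lemma in_transversal_inj n (L : 'I_n -> 'I_n -> 'I_n) (u : 'I_n -> 'I_n) r :
  injective u -> injective (fun x => L x (u x)) -> in_transversal L r (u r).
Proof.
move=> uinj Linj; apply/existsP; exists (perm uinj); rewrite permE eqxx andbT.
by apply/injectiveP => x y /=; rewrite !permE => /Linj.
Qed.

Lemma tau_add n (L : 'I_n -> 'I_n -> 'I_n) :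
  tau L + #|[set rc : 'I_n * 'I_n | in_transversal L rc.1 rc.2]| = n ^ 2.
Proof.
have -> : n ^ 2 = #|{: 'I_n * 'I_n}| by rewrite card_prod card_ord.
rewrite -(cardsC [set rc : 'I_n * 'I_n | in_transversal L rc.1 rc.2]) addnC; congr (_ + #|pred_of_set _|).
by apply/setP => rc; rewrite !inE.
Qed.

Lemma tau_lt n (L : 'I_n -> 'I_n -> 'I_n) r c :
  in_transversal L r c -> tau L < n ^ 2.
Proof.
move=> it; rewrite -(tau_add L) -[X in X < _]addn0 ltn_add2l card_gt0.
by apply/set0Pn; exists (r, c); rewrite inE.
Qed.

(* Inclusion-exclusion in each row; a pair in [C x S] is met in one row only. *)
Lemma card_avoid n (L : 'I_n -> 'I_n -> 'I_n) (A C S : {set 'I_n}) : is_latin_square L ->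
  #|[set rc : 'I_n * 'I_n | [&& rc.1 \in A, rc.2 \notin C & L rc.1 rc.2 \notin S]]|
    + #|A| * (#|C| + #|S|) <= #|A| * n + #|C| * #|S|.
Proof.
move=> [rowi coli].
pose N r := [set c | (c \notin C) && (L r c \notin S)].
pose I r := [set c | (c \in C) && (L r c \in S)].
have E1 : #|[set rc : 'I_n * 'I_n | [&& rc.1 \in A, rc.2 \notin C & L rc.1 rc.2 \notin S]]|
    = \sum_(r in A) #|N r|.
  rewrite -sum1_card (eq_bigl (fun rc => (rc.1 \in A) && (rc.2 \in N rc.1))); last first.
    by move=> rc; rewrite !inE.
  rewrite -(pair_big_dep (fun r => r \in A) (fun r c => c \in N r) (fun _ _ => 1)) /=.
  by apply: eq_bigr => r _; rewrite sum1_card.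
have E2 r : #|N r| + (#|C| + #|S|) = n + #|I r|.
  have SE : #|S| = #|[set c | L r c \in S]| by rewrite -(card_preimset S (rowi r)).
  rewrite SE -cardsUI.
  have -> : C :&: [set c | L r c \in S] = I r by apply/setP => c; rewrite !inE.
  have -> : N r = ~: (C :|: [set c | L r c \in S]) by apply/setP => c; rewrite !inE negb_or.
  by rewrite addnA [X in X + _]addnC cardsC card_ord.
have E3 : \sum_(r in A) #|I r| <= #|C| * #|S|.
  have -> : \sum_(r in A) #|I r| = #|[set rc : 'I_n * 'I_n | (rc.1 \in A) && (rc.2 \in I rc.1)]|.
    rewrite -sum1_card (eq_bigl (fun rc => (rc.1 \in A) && (rc.2 \in I rc.1))); last first.
      by move=> rc; rewrite !inE.
    rewrite -(pair_big_dep (fun r => r \in A) (fun r c => c \in I r) (fun _ _ => 1)) /=.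
    by apply: eq_bigr => r _; rewrite sum1_card.
  rewrite -cardsX -(card_in_imset (f := fun rc : 'I_n * 'I_n => (rc.2, L rc.1 rc.2))); last first.
    move=> [r c] [r' c'] _ _ /= [<- H]; congr (_, _); exact: (coli c).
  apply: subset_leq_card; apply/subsetP => _ /imsetP[[r c] + ->].
  by rewrite !inE /=; case/and3P => _ -> ->.
rewrite E1 -sum_nat_const -big_split /= (eq_bigr (fun r => n + #|I r|)); last by move=> r _; exact: E2.
by rewrite big_split /= sum_nat_const leq_add2l.
Qed.

(** With [f r c = r] this is the Cayley table of Z_n, used for comparison in the count. *)
Definition shifted (n : nat) (n0 : 0 < n) (f : nat -> nat -> nat) (r c : 'I_n) : 'I_n :=
  Ordinal (ltn_pmod (c + f r c) n0).

Lemma shifted_latin n (n0 : 0 < n) f :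
  (forall r c, r < n -> c < n -> f r c < n) ->
  (forall r c1 c2, r < n -> c1 < n -> c2 < n ->
     c1 + f r c1 = c2 + f r c2 %[mod n] -> c1 = c2) ->
  (forall r1 r2 c, r1 < n -> r2 < n -> c < n -> f r1 c = f r2 c -> r1 = r2) ->
  is_latin_square (shifted n0 f).
Proof.
move=> flt rowi coli; split=> [r c1 c2 | c r1 r2] /(congr1 val) /= H; apply: val_inj.
  exact: (rowi r c1 c2).
apply: (coli r1 r2 c); rewrite ?ltn_ord //; move/eqP: H.
by rewrite eqn_modDl !modn_small ?flt // => /eqP.
Qed.

(** * The latin squares *)

Definition swap3 (i : nat) (o : bool) : nat := if o then 2 - i else i.

(* In columns away from [m], rows 0 and 2 of a slab are swapped in every second
   column and row 1 is left alone; the only cell of row 1 with the value 2 is in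
   column [m]. *)
Definition slab (i m c : nat) : nat :=
  if c == m then nth 0 [:: 0; 2; 1] i
  else if c == m.+1 then nth 0 [:: 2; 0; 1] i
  else swap3 i (odd (c + m)).

(* All rows attain their maximum above the mean (by 2 for row 0, by 1 for the
   others) but none goes more than 1 below it: this asymmetry excludes total
   displacement [- n / 2]. *)
Definition quad (i c : nat) : nat :=
  nth 0 (if c < 6 then nth [::] [:: [:: 3; 0; 2; 1]; [:: 0; 1; 3; 2]; [:: 0; 2; 1; 3]] (c %% 3)
         else if odd c then [:: 0; 2; 1; 3] else [:: 2; 0; 3; 1]) i.

(* The square has [c + lab k a b r c] (mod n) in row [r], column [c].  Rows
   [k, a) form slabs of three rows without a forced cell, rows [a, a + 4) a
   block of four rows, rows from [b] on slabs of three rows with a forced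
   cell; all other rows are those of Z_n. *)
Definition lab (k a b r c : nat) : nat :=
  if b <= r then let i := (r - b) %% 3 in r - i + slab i (r - i) c
  else if a + 4 <= r then r
  else if a <= r then a + quad (r - a) c
  else if k <= r then let i := (r - k) %% 3 in r - i + swap3 i (odd c)
  else r.

(* [r + excess k a b r] is the maximum of [lab k a b r c] over [c], and
   [width k a b r] the difference of maximum and minimum. *)
Definition excess (k a b r : nat) : nat :=
  if b <= r then 2 - (r - b) %% 3
  else if a + 4 <= r then 0
  else if a <= r then nth 0 [:: 3; 1; 1; 0] (r - a)
  else if k <= r then nth 0 [:: 2; 0; 0] ((r - k) %% 3)
  else 0.

Definition width (k a b r : nat) : nat :=
  if b <= r then 2
  else if a + 4 <= r then 0
  else if a <= r then nth 0 [:: 3; 2; 2; 2] (r - a)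
  else if k <= r then nth 0 [:: 2; 0; 2] ((r - k) %% 3)
  else 0.

(** * The latin property *)

Lemma swap3_le i d : i < 3 -> swap3 i d <= 2.
Proof. by rewrite /swap3; case: d; lia. Qed.

Lemma swap3_inj i j d : i < 3 -> j < 3 -> swap3 i d = swap3 j d -> i = j.
Proof. by rewrite /swap3; case: d; lia. Qed.

Lemma slab_le i m c : i < 3 -> slab i m c <= 2.
Proof.
by rewrite /slab /swap3; case: eqP => _; [|case: eqP => _; [|case: odd; lia]];
  case: i => [|[|[|]]].
Qed.

Lemma slab_inj i j m c : i < 3 -> j < 3 -> slab i m c = slab j m c -> i = j.
Proof.
rewrite /slab; case: eqP => _; [|case: eqP => _; [|exact: swap3_inj]];
  move: i j => [|[|[|i]]] [|[|[|j]]] //=.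
Qed.

Lemma quad_le i c : i < 4 -> quad i c <= 3.
Proof.
move=> hi; rewrite /quad; case: ltnP => _; last by case: (odd c); case: i hi => [|[|[|[|]]]].
by case: (mod3P c) => ->; case: i hi => [|[|[|[|]]]].
Qed.

Lemma quad_inj i j c : i < 4 -> j < 4 -> quad i c = quad j c -> i = j.
Proof.
move=> hi hj; rewrite /quad; case: ltnP => _; last by
  case: (odd c); move: i hi j hj => [|[|[|[|i]]]] // _ [|[|[|[|j]]]].
by case: (mod3P c) => ->; move: i hi j hj => [|[|[|[|i]]]] // _ [|[|[|[|j]]]].
Qed.

(** Each row moves columns of equal parity equally; rows 0 and 2 move by 0 or 2, which keeps parity
    since [n] is even. *)
Lemma swap3_row (n i c1 c2 : nat) (d : bool) : i < 3 -> c1 < n -> c2 < n -> 10 <= n -> ~~ odd n ->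
  c1 + swap3 i (odd c1 (+) d) = c2 + swap3 i (odd c2 (+) d) %[mod n] -> c1 = c2.
Proof.
move=> hi h1 h2 hn on.
have b1 := swap3_le (odd c1 (+) d) hi; have b2 := swap3_le (odd c2 (+) d) hi.
move/modn_small_inj => /(_ ltac:(lia) ltac:(lia)).
rewrite /swap3; case: d {b1 b2}; case: (boolP (odd c1)) => o1; case: (boolP (odd c2)) => o2 /= []; lia.
Qed.

(** Columns [m] and [m.+1] differ from the alternating pattern by switching an intercalate in rows 1
    and 2, so each row keeps its set of symbols. *)
Lemma slab_row (n i m c1 c2 : nat) : i < 3 -> m.+2 < n -> c1 < n -> c2 < n -> 10 <= n -> ~~ odd n ->
  c1 + slab i m c1 = c2 + slab i m c2 %[mod n] -> c1 = c2.
Proof.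
move=> hi hm h1 h2 hn on.
have b1 := slab_le m c1 hi; have b2 := slab_le m c2 hi.
move/modn_small_inj => /(_ ltac:(lia) ltac:(lia)).
rewrite /slab /swap3 !oddD {b1 b2}.
case: (boolP (odd m)) => om; case: i hi => [|[|[|]]] // _ /=;
 (case: (c1 =P m) => e1; [|case: (c1 =P m.+1) => f1; [|case: (boolP (odd c1)) => o1]]);
 (case: (c2 =P m) => e2; [|case: (c2 =P m.+1) => f2; [|case: (boolP (odd c2)) => o2]]);
 move=> /= []; lia.
Qed.

(** In each row the first six columns take exactly the symbols missed by the alternating columns,
    which wrap past [n]. *)
Lemma quad_row (n i c1 c2 : nat) : i < 4 -> c1 < n -> c2 < n -> 10 <= n -> ~~ odd n ->
  c1 + quad i c1 = c2 + quad i c2 %[mod n] -> c1 = c2.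
Proof.
move=> hi h1 h2 hn on.
have b1 := quad_le c1 hi; have b2 := quad_le c2 hi.
move/modn_small_inj => /(_ ltac:(lia) ltac:(lia)).
rewrite /quad; move: b1 b2 => _ _.
case: (ltnP c1 6) => d1; [case: (mod3P c1) => m1 | case: (boolP (odd c1)) => o1];
 (case: (ltnP c2 6) => d2; [case: (mod3P c2) => m2 | case: (boolP (odd c2)) => o2]);
 rewrite ?m1 ?m2; case: i hi => [|[|[|[|]]]] //= _ [] ; lia.
Qed.

(** Each block of rows permutes its own labels, so only rows of one block could clash. *)
Lemma lab_col_inj k a b h r1 r2 c : a = k + 3 * h -> a + 4 <= b -> lab k a b r1 c = lab k a b r2 c -> r1 = r2.
Proof.
move=> ka ab; rewrite /lab.
have := @slab_le ((r1 - b) %% 3) (r1 - (r1 - b) %% 3) c (lt3 _).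
have := @slab_le ((r2 - b) %% 3) (r2 - (r2 - b) %% 3) c (lt3 _).
have := @swap3_le ((r1 - k) %% 3) (odd c) (lt3 _).
have := @swap3_le ((r2 - k) %% 3) (odd c) (lt3 _).
have := @quad_le (r1 - a) c; have := @quad_le (r2 - a) c.
case: (leqP b r1) => b1; [|case: (leqP (a + 4) r1) => n1; [|case: (leqP a r1) => a1; [|case: (leqP k r1) => k1]]];
(case: (leqP b r2) => b2; [|case: (leqP (a + 4) r2) => n2; [|case: (leqP a r2) => a2; [|case: (leqP k r2) => k2]]]);
 move=> /= q2 q1 w2 w1 s2 s1 H; try lia.
- have E : r1 - (r1 - b) %% 3 = r2 - (r2 - b) %% 3 by lia.
  move: H; rewrite E => /addnI /slab_inj -/(_ (lt3 _) (lt3 _)); lia.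
- move: H => /addnI /quad_inj; lia.
- have E : r1 - (r1 - k) %% 3 = r2 - (r2 - k) %% 3 by lia.
  move: H; rewrite E => /addnI /swap3_inj -/(_ (lt3 _) (lt3 _)); lia.
Qed.

Lemma lab_row_inj n k a b g r c1 c2 : n = b + 3 * g -> 10 <= n -> ~~ odd n -> r < n -> c1 < n -> c2 < n ->
  c1 + lab k a b r c1 = c2 + lab k a b r c2 %[mod n] -> c1 = c2.
Proof.
move=> bn n10 on hr h1 h2; rewrite /lab.
have C x v1 v2 : c1 + (x + v1) = c2 + (x + v2) %[mod n] -> c1 + v1 = c2 + v2 %[mod n].
  by move/eqP; rewrite ![_ + (x + _)]addnCA eqn_modDl => /eqP.
have D x : c1 + x = c2 + x %[mod n] -> c1 = c2.
  by move/eqP; rewrite eqn_modDr => /eqP; rewrite !modn_small.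
case: (leqP b r) => br; [|case: (leqP (a + 4) r) => n1; [|case: (leqP a r) => a1; [|case: (leqP k r) => k1]]]; rewrite /=.
- move/C/slab_row; apply; lia.
- exact: D.
- move/C/quad_row; apply; lia.
- move/C; rewrite -(addbF (odd c1)) -(addbF (odd c2)) => /swap3_row; apply; lia.
- exact: D.
Qed.

Lemma lab_lt n k a b h g r c : a = k + 3 * h -> a + 4 <= b -> n = b + 3 * g -> r < n -> lab k a b r c < n.
Proof.
move=> ka ab bn hr; rewrite /lab.
case: (leqP b r) => br; [|case: (leqP (a + 4) r) => n1; [|case: (leqP a r) => a1; [|case: (leqP k r) => k1]]]; rewrite /=.
- have := @slab_le ((r - b) %% 3) (r - (r - b) %% 3) c (lt3 _); lia.
- lia.
- have := @quad_le (r - a) c; lia.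
- have := @swap3_le ((r - k) %% 3) (odd c) (lt3 _); lia.
- lia.
Qed.

(** * Maxima and widths of the rows *)

Lemma lab_excess k a b r c : lab k a b r c <= r + excess k a b r <= lab k a b r c + width k a b r.
Proof.
rewrite /lab /excess /width.
case: (leqP b r) => br; [|case: (leqP (a + 4) r) => n1; [|case: (leqP a r) => a1; [|case: (leqP k r) => k1]]]; rewrite /=.
- have := @slab_le ((r - b) %% 3) (r - (r - b) %% 3) c (lt3 _); lia.
- lia.
- have [i -> hi] : exists2 i, r = a + i & i < 4 by exists (r - a); lia.
  rewrite addKn /quad; case: ltnP => _.
    by case: (mod3P c) => ->; move: i hi => [|[|[|[|i]]]] /=; lia.
  by case: odd; move: i hi => [|[|[|[|i]]]] /=; lia.
- move: (lt3 (r - k)) (leq_mod (r - k) 3); move: ((r - k) %% 3) => i.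
  by rewrite /swap3; case: odd; move: i => [|[|[|i]]] /=; lia.
- lia.
Qed.

Lemma sum_blocks3 (F : nat -> nat) (m g : nat) : (forall i, F i.+3 = F i) ->
  \sum_(m <= i < m + 3 * g) F (i - m) = g * (F 0 + F 1 + F 2).
Proof.
move=> per; rewrite -{1}[m]add0n big_addn addKn.
under eq_bigr do rewrite addnK.
elim: g => [|g IH]; first by rewrite big_geq.
rewrite mulnS add3n !big_nat_recl //= [g.+1 * _]mulSn -IH; under eq_bigr do rewrite per.
by rewrite !addnA.
Qed.

Lemma sum_pieces (f : nat -> nat) (F0 F1 F2 : nat -> nat) k a b h g :
  a = k + 3 * h -> a + 4 <= b ->
  (forall r, f r = if b <= r then F0 ((r - b) %% 3)
                   else if a + 4 <= r then 0
                   else if a <= r then F1 (r - a)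
                   else if k <= r then F2 ((r - k) %% 3)
                   else 0) ->
  \sum_(0 <= r < b + 3 * g) f r =
    g * (F0 0 + F0 1 + F0 2) + (F1 0 + F1 1 + F1 2 + F1 3) + h * (F2 0 + F2 1 + F2 2).
Proof.
move=> ka ab fE.
rewrite (@big_cat_nat _ _ _ b) /=; [|lia..].
rewrite (@big_cat_nat _ _ _ (a + 4) 0 b) /=; [|lia..].
rewrite (@big_cat_nat _ _ _ a 0 (a + 4)) /=; [|lia..].
rewrite (@big_cat_nat _ _ _ k 0 a) /=; [|lia..].
rewrite (@eq_big_nat _ _ _ 0 k f (fun=> 0)); last first.
  move=> r hr; rewrite fE !ifN //; lia.
rewrite (@eq_big_nat _ _ _ k a f (fun r => F2 ((r - k) %% 3))); last first.
  move=> r /andP[kr ra]; rewrite fE kr !ifN //; lia.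
rewrite (@eq_big_nat _ _ _ a (a + 4) f (fun r => F1 (r - a))); last first.
  move=> r /andP[kr ra]; rewrite fE kr !ifN //; lia.
rewrite (@eq_big_nat _ _ _ (a + 4) b f (fun=> 0)); last first.
  move=> r /andP[kr ra]; rewrite fE kr ifN //; lia.
rewrite (@eq_big_nat _ _ _ b _ f (fun r => F0 ((r - b) %% 3))); last first.
  by move=> r /andP[kr ra]; rewrite fE kr.
rewrite !big1_eq (@sum_blocks3 (fun i => F0 (i %% 3))); last by move=> i; rewrite -addn3 modnDr.
have -> : \sum_(k <= r < a) F2 ((r - k) %% 3) = h * (F2 0 + F2 1 + F2 2).
  by rewrite ka (@sum_blocks3 (fun i => F2 (i %% 3))) // => i; rewrite -addn3 modnDr.
have -> : \sum_(a <= r < a + 4) F1 (r - a) = F1 0 + F1 1 + F1 2 + F1 3.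
  rewrite -{1}[a]add0n big_addn addKn; under eq_bigr do rewrite addnK.
  by rewrite !big_nat_recl // big_geq // addn0 !addnA.
by rewrite add0n addn0 addnC [X in _ + X = _]addnC addnA.
Qed.

(** For order [n = 6 * g + 10 + 4 * h] this is [n./2], just what makes the maxima sum to a multiple
    of [n]. *)
Lemma sum_excess k a b h g : a = k + 3 * h -> a + 4 <= b ->
  \sum_(0 <= r < b + 3 * g) excess k a b r = 3 * g + 5 + 2 * h.
Proof.
move=> ka ab.
rewrite (@sum_pieces _ (fun i => 2 - i) (nth 0 [:: 3; 1; 1; 0]) (nth 0 [:: 2; 0; 0]) k a b h g) //=; lia.
Qed.

(** For the same order this is [n - 1], the largest total that [transversal_tight] admits. *)
Lemma sum_width k a b h g : a = k + 3 * h -> a + 4 <= b ->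
  \sum_(0 <= r < b + 3 * g) width k a b r = 6 * g + 9 + 4 * h.
Proof.
move=> ka ab.
rewrite (@sum_pieces _ (fun i => 2) (nth 0 [:: 3; 2; 2; 2]) (nth 0 [:: 2; 0; 2]) k a b h g) //=; lia.
Qed.

(** * Counting the cells in transversals *)

Lemma lab_middle k a b m c : b <= m -> (m - b) %% 3 = 1 ->
  lab k a b m c = m + excess k a b m -> c = m.-1.
Proof.
move=> bm m1; rewrite /lab /excess bm m1 /slab /swap3.
case: eqP => [-> _|_]; first by rewrite subn1.
case: eqP => _; first by rewrite /=; lia.
by case: odd => /=; lia.
Qed.

(** The term [g] counts the forced cells; the others inject into Z_n with at most [b + g] labels,
    avoiding [g] columns and [g] symbols. *)
Lemma card_in_transversal k a b h g n (n0 : 0 < n) :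
  a = k + 3 * h -> a + 4 <= b -> b = 3 * g + 10 + 4 * h -> n = b + 3 * g ->
  #|[set rc : 'I_n * 'I_n | in_transversal (shifted n0 (lab k a b)) rc.1 rc.2]|
    <= g + (b + g) ^ 2 + g ^ 2.
Proof.
move=> ka ab bg bn.
set L := shifted n0 (lab k a b).
have n10 : 10 <= n by lia.
have on : ~~ odd n by lia.
have tight s : Defs.is_transversal L s -> forall r : 'I_n, lab k a b r (s r) = r + excess k a b r.
  apply: (transversal_tight (lb := fun r c => lab k a b r c) (w := fun r => width k a b r)).
  - by move=> r c; rewrite /= modn_mod.
  - by move=> r c; exact: lab_excess.
  - rewrite big_split /=.
    rewrite -(big_mkord xpredT (fun r => r)) -(big_mkord xpredT (excess k a b)).
    have := sum_excess g ka ab; rewrite -bn => ->; rewrite bin2_sum bin2.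
    have -> : 3 * g + 5 + 2 * h = n./2 by lia.
    have -> : (n * n.-1)./2 = n./2 * n.-1 by rewrite -{1}(even_halfK on) -doubleMl doubleK.
    by rewrite -[X in _ + X]muln1 -mulnDr addn1 prednK // dvdn_mull.
  - rewrite -(big_mkord xpredT (width k a b)) [X in \sum_(0 <= _ < X) _]bn (sum_width _ ka ab); lia.
have rowlt j i : i < 3 -> j < g -> b + 3 * j + i < n by lia.
pose col (j : 'I_g) : 'I_n := Ordinal (rowlt j 0 isT (ltn_ord j)).
pose mid (j : 'I_g) : 'I_n := Ordinal (rowlt j 1 isT (ltn_ord j)).
pose top (j : 'I_g) : 'I_n := Ordinal (rowlt j 2 isT (ltn_ord j)).
have b_le : b <= n by lia.
(* Labels a tight cell can have: rows below [b] keep labels below [b], and each slab only allows its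
   top label. *)
pose A := [set widen_ord b_le x | x : 'I_b] :|: [set top j | j : 'I_g].
pose C := [set col j | j : 'I_g].
pose S := [set L (mid j) (col j) | j : 'I_g].
have tmid s j : Defs.is_transversal L s -> s (mid j) = col j.
  move=> ts; apply: val_inj; rewrite /= addn0.
  have := tight s ts (mid j) => /lab_middle -> /=; lia.
pose P := [set rc : 'I_n * 'I_n | in_transversal L rc.1 rc.2 &
  ~~ ((b <= rc.1) && ((rc.1 - b) %% 3 == 1))].
have cover : [set rc : 'I_n * 'I_n | in_transversal L rc.1 rc.2]
    \subset [set (mid j, col j) | j : 'I_g] :|: P.
  apply/subsetP => -[r c]; rewrite !inE /= => /[dup] it ->.
  case: (boolP ((b <= r) && ((r - b) %% 3 == 1))) => [/andP[br /eqP r1]|_]; last by rewrite orbT.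
  apply/orP; left; apply/imsetP.
  have jg : (r - b) %/ 3 < g by have := ltn_ord r; lia.
  exists (Ordinal jg) => //.
  have rE : r = mid (Ordinal jg) by apply: val_inj => /=; lia.
  case/existsP: it => s /andP[ts /eqP <-].
  by rewrite {2}rE (tmid s) // -rE.
apply: leq_trans (subset_leq_card cover) _.
apply: leq_trans (leq_card_setU _ _) _.
rewrite -addnA leq_add //; first by apply: leq_trans (leq_imset_card _ _) _; rewrite card_ord.
pose Q := [set rc : 'I_n * 'I_n | [&& rc.1 \in A, rc.2 \notin C & shifted n0 (fun l _ => l) rc.1 rc.2 \notin S]].
have PQ : #|P| <= #|Q|.
  have lt r c := lab_lt c ka ab bn (ltn_ord r).
  (* Replacing the row by the label turns a cell into the cell of Z_n with the same column and
     symbol. *)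
  pose phi (rc : 'I_n * 'I_n) : 'I_n * 'I_n := (Ordinal (lt rc.1 rc.2), rc.2).
  rewrite -(card_in_imset (f := phi)); last first.
    move=> [r c] [r' c'] _ _ [] /= + cc; rewrite -cc => /(lab_col_inj ka ab) rr.
    by congr (_, _) => //; apply: val_inj.
  apply: subset_leq_card; apply/subsetP => _ /imsetP[[r c] + ->].
  rewrite !inE /= => /andP[/existsP[s /andP[ts /eqP src]] nmid].
  have rn j : r != mid j.
    apply: contraNneq nmid => ->; rewrite /= -addnA leq_addr addKn.
    by rewrite mulnC modnMDl.
  apply/and3P; split.
  - have := tight s ts r; rewrite src => lE.
    case: (ltnP r b) => rb.
      apply/orP; left; apply/imsetP.
      have lb : lab k a b r c < b by apply: (@lab_lt b k a b h 0) => //; lia.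
      by exists (Ordinal lb) => //; apply: val_inj.
    apply/orP; right; apply/imsetP.
    have jg : (r - b) %/ 3 < g by have := ltn_ord r; lia.
    exists (Ordinal jg) => //; apply: val_inj; rewrite /= lE /excess rb.
    by move: nmid; rewrite rb /=; lia.
  - apply/imsetP => -[j _ cj]; move: (rn j); rewrite -(inj_eq (@perm_inj _ s)) src (tmid s) //.
    by rewrite cj eqxx.
  - apply/imsetP => -[j _ Lj].
    have /(injectiveP _ ts) rm : L r (s r) = L (mid j) (s (mid j)).
      by rewrite src (tmid s) // -Lj; apply: val_inj.
    by move: (rn j); rewrite rm eqxx.
have lsq : is_latin_square (shifted n0 (fun l _ => l)).
  apply: shifted_latin => // r c1 c2 _ h1 h2 /eqP.
  by rewrite eqn_modDr !modn_small // => /eqP.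
have := card_avoid A C S lsq; rewrite -/Q.
have cC : #|C| = g.
  rewrite card_imset ?card_ord // => i j /(congr1 val) /= H; apply: val_inj => /=; lia.
have cA : #|A| <= b + g.
  apply: leq_trans (leq_card_setU _ _) _.
  by apply: leq_add; apply: leq_trans (leq_imset_card _ _) _; rewrite card_ord.
have cS : #|S| = g.
  have lm (j : 'I_g) : lab k a b (mid j) (col j) = b + 3 * j + 2.
    have m1 : (b + 3 * j + 1 - b) %% 3 = 1 by rewrite -addnA addKn mulnC modnMDl.
    by rewrite /lab /= -addnA leq_addr addnA m1 addnK /slab addn0 eqxx.
  rewrite card_imset ?card_ord // => i j /(congr1 val); rewrite /L /shifted [val _]/= [RHS]/= !lm => /eqP.
  (* The forced symbols are [2 * b + 2 + 6 * j] modulo [n], distinct because [6 * j < n]. *)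
  have E x : b + 3 * x + 0 + (b + 3 * x + 2) = (b + b + 2) + 6 * x by lia.
  rewrite !E eqn_modDl !modn_small; first by move/eqP => H; apply: val_inj => /=; lia.
    by have := ltn_ord j; lia.
  by have := ltn_ord i; lia.
rewrite cC cS; move: PQ cA; move: #|P| #|Q| #|A| => p q x pq xb H.
(* Thus [b + g] is also what remains of a row without [g] columns and [g] symbols. *)
have bgn : b + g + (g + g) = n by lia.
have : q <= x * (b + g) + g ^ 2.
  rewrite -(leq_add2r (x * (g + g))) addnAC -mulnDr bgn.
  by rewrite -mulnn.
move=> Hq; apply: leq_trans pq _; apply: leq_trans Hq _.
by rewrite leq_add2r -mulnn leq_mul2r xb orbT.
Qed.

(** * An explicit transversal *)

(* Column chosen in row [r] by the transversal; [core] gives it on the rows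
   [0, x) and [x + 3 * g, b), which are renumbered consecutively. *)
Definition diag (x g b : nat) (core : seq nat) (r : nat) : nat :=
  if b <= r then let i := (r - b) %% 3 in r - i + nth 0 [:: 1; 0; 2] i
  else if r < x then nth 0 core r
  else if r < x + 3 * g then let i := (r - x) %% 3 in r - i + nth 0 [:: 2; 0; 1] i
  else 3 * g + nth 0 core (r - 3 * g).

(* The symbols of the transversal modulo [n], represented in [2, n + 2). *)
Definition diag_sum (x g b e : nat) (sums : seq nat) (r : nat) : nat :=
  if b <= r then let i := (r - b) %% 3 in e + 2 + 2 * (r - b - i) + nth 0 [:: 1; 0; 2] i
  else if r < x then nth 0 sums r
  else if r < x + 3 * g then let i := (r - x) %% 3 in e + 4 + 2 * (r - x - i) + nth 0 [:: 2; 1; 3] i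
  else nth 0 sums (r - 3 * g).

(** Coordinates for the four ranges of rows, so that later case splits become linear. *)
Variant diag_spec (x g b e : nat) (core sums : seq nat) (r : nat) : nat -> nat -> Prop :=
  | DiagStart of r < x :
      diag_spec x g b e core sums r (nth 0 core r) (nth 0 sums r)
  | DiagBulk j i of j < g & i < 3 & r = x + 3 * j + i :
      diag_spec x g b e core sums r (x + 3 * j + nth 0 [:: 2; 0; 1] i)
        (e + 4 + 6 * j + nth 0 [:: 2; 1; 3] i)
  | DiagEnd p of x <= p < e & r = 3 * g + p :
      diag_spec x g b e core sums r (3 * g + nth 0 core p) (nth 0 sums p)
  | DiagSlab j i of j < g & i < 3 & r = b + 3 * j + i :
      diag_spec x g b e core sums r (b + 3 * j + nth 0 [:: 1; 0; 2] i)
        (e + 2 + 6 * j + nth 0 [:: 1; 0; 2] i).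

Lemma diagP x g b e n core sums r :
  b = 3 * g + e -> n = b + 3 * g -> x <= e -> r < n ->
  diag_spec x g b e core sums r (diag x g b core r) (diag_sum x g b e sums r).
Proof.
move=> bE nE xe hr; rewrite /diag /diag_sum.
case: (leqP b r) => br.
  have [|j [i [jg i3 rE im]]] := @split3 b g r; first by lia.
  have E1 : r - i = b + 3 * j by lia.
  have E2 : 2 * (r - b - i) = 6 * j by lia.
  by rewrite /= im E1 E2; exact: DiagSlab.
case: (ltnP r x) => rx; first exact: DiagStart.
case: (ltnP r (x + 3 * g)) => rg.
  have [|j [i [jg i3 rE im]]] := @split3 x g r; first by lia.
  have E1 : r - i = x + 3 * j by lia.
  have E2 : 2 * (r - x - i) = 6 * j by lia.
  by rewrite /= im E1 E2; exact: DiagBulk.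
by apply: DiagEnd; lia.
Qed.

Lemma diag_lt x g b e n core r :
  b = 3 * g + e -> n = b + 3 * g -> x <= e -> size core = e -> all (ltn^~ e) core ->
  r < n -> diag x g b core r < n.
Proof.
move=> bE nE xe sz /(all_nthP 0) lt hr.
have B p : p < e -> nth 0 core p < e by move=> hp; apply: lt; rewrite sz.
case: (diagP core [::] bE nE xe hr).
- by move=> rx; have := B r; lia.
- by move=> j i jg; case: i => [|[|[|]]] //=; lia.
- by move=> p /andP[_ pe] _; have := B p pe; lia.
- by move=> j i jg; case: i => [|[|[|]]] //=; lia.
Qed.

(** Since [core] preserves the part below [x], the four ranges of rows use disjoint ranges of
    columns. *)
Lemma diag_inj x g b e n core r1 r2 :
  b = 3 * g + e -> n = b + 3 * g -> x <= e -> size core = e -> uniq core ->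
  (forall p, p < e -> (nth 0 core p < x) = (p < x)) -> all (ltn^~ e) core ->
  r1 < n -> r2 < n -> diag x g b core r1 = diag x g b core r2 -> r1 = r2.
Proof.
move=> bE nE xe sz un start /(all_nthP 0) lt h1 h2.
have I p q : p < e -> q < e -> nth 0 core p = nth 0 core q -> p = q.
  by move=> hp hq /eqP; rewrite nth_uniq ?sz // => /eqP.
have S p : p < x -> nth 0 core p < x by move=> px; rewrite start //; lia.
have E p : x <= p < e -> x <= nth 0 core p < e.
  move=> /andP[xp pe]; rewrite leqNgt (start p pe) -leqNgt xp.
  by apply: lt; rewrite sz.
have U i : i < 3 -> nth 0 [:: 1; 0; 2] i <= 2 by case: i => [|[|[|]]].
have V i : i < 3 -> nth 0 [:: 2; 0; 1] i <= 2 by case: i => [|[|[|]]].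
case: (diagP core [::] bE nE xe h1) => [/[dup] p1 /S s1|j1 i1 hj1 /[dup] hi1 /V v1 e1|p1 /[dup] hp1 /E E1 e1|j1 i1 hj1 /[dup] hi1 /U u1 e1];
case: (diagP core [::] bE nE xe h2) => [/[dup] p2 /S s2|j2 i2 hj2 /[dup] hi2 /V v2 e2|p2 /[dup] hp2 /E E2 e2|j2 i2 hj2 /[dup] hi2 /U u2 e2] H;
try by [lia].
- by apply: I => //; lia.
- have ee : nth 0 [:: 2; 0; 1] i1 = nth 0 [:: 2; 0; 1] i2 by lia.
  by have := nth3_inj hi1 hi2 ee isT; lia.
- by rewrite e1 e2 (I p1 p2) //; lia.
- have ee : nth 0 [:: 1; 0; 2] i1 = nth 0 [:: 1; 0; 2] i2 by lia.
  by have := nth3_inj hi1 hi2 ee isT; lia.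
Qed.

(** The core fills [[2, e + 2)]; above it, each run of six symbols is split between a slab (lower
    three) and three rows of Z_n (upper three). *)
Lemma diag_sum_inj x g b e n sums r1 r2 :
  b = 3 * g + e -> n = b + 3 * g -> x <= e -> 2 * x = e + 4 -> size sums = e -> uniq sums ->
  all (fun s => 2 <= s < e + 2) sums ->
  r1 < n -> r2 < n -> diag_sum x g b e sums r1 = diag_sum x g b e sums r2 %[mod n] -> r1 = r2.
Proof.
move=> bE nE xe x2 sz un /(all_nthP 0) lt h1 h2.
have B p : p < e -> 2 <= nth 0 sums p < e + 2 by move=> hp; apply: lt; rewrite sz.
have I p q : p < e -> q < e -> nth 0 sums p = nth 0 sums q -> p = q.
  by move=> hp hq /eqP; rewrite nth_uniq ?sz // => /eqP.
have S p : p < x -> 2 <= nth 0 sums p < e + 2 by move=> px; apply: B; lia.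
have E p : x <= p < e -> 2 <= nth 0 sums p < e + 2 by move=> px; apply: B; lia.
have U i : i < 3 -> nth 0 [:: 1; 0; 2] i <= 2 by case: i => [|[|[|]]].
have V i : i < 3 -> 1 <= nth 0 [:: 2; 1; 3] i <= 3 by case: i => [|[|[|]]].
have R r : r < n -> 2 <= diag_sum x g b e sums r < n + 2.
  move=> hr; case: (diagP [::] sums bE nE xe hr) => [/S|j i hj /V|p /E|j i hj /U]; lia.
move=> H; have {H} : diag_sum x g b e sums r1 = diag_sum x g b e sums r2.
  have := R _ h1; have := R _ h2; move: (diag_sum _ _ _ _ _ _) (diag_sum _ _ _ _ _ _) H => s1 s2 H b1 b2.
  have : s1 - 2 = s2 - 2 %[mod n].
    by apply/eqP; rewrite -(eqn_modDr 2) !subnK; [exact/eqP|lia|lia].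
  by rewrite !modn_small; lia.
case: (diagP [::] sums bE nE xe h1) => [/[dup] p1 /S s1|j1 i1 hj1 /[dup] hi1 /V v1 e1|p1 /[dup] hp1 /E E1 e1|j1 i1 hj1 /[dup] hi1 /U u1 e1];
case: (diagP [::] sums bE nE xe h2) => [/[dup] p2 /S s2|j2 i2 hj2 /[dup] hi2 /V v2 e2|p2 /[dup] hp2 /E E2 e2|j2 i2 hj2 /[dup] hi2 /U u2 e2] H;
try by [lia].
- by apply: I => //; lia.
- by have := I r1 p2; lia.
- have ee : nth 0 [:: 2; 1; 3] i1 = nth 0 [:: 2; 1; 3] i2 by lia.
  by have := nth3_inj hi1 hi2 ee isT; lia.
- by have := I p1 r2; lia.
- by rewrite e1 e2 (I p1 p2) //; lia.
- have ee : nth 0 [:: 1; 0; 2] i1 = nth 0 [:: 1; 0; 2] i2 by lia.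
  by have := nth3_inj hi1 hi2 ee isT; lia.
Qed.

(** In the end and slab ranges the two sides differ by exactly [n], elsewhere they are equal;
    [2 * x = e + 4] aligns the inserted rows of Z_n. *)
Lemma diag_sumE k a x g b e n core sums r :
  a + 4 <= x -> b = 3 * g + e -> n = b + 3 * g -> x <= e -> 2 * x = e + 4 ->
  (forall p, p < x -> nth 0 core p + (p + excess k a x p) = nth 0 sums p) ->
  (forall p, x <= p < e -> nth 0 core p + p = e + nth 0 sums p) ->
  r < n -> diag x g b core r + (r + excess k a b r) = diag_sum x g b e sums r %[mod n].
Proof.
move=> ax bE nE xe x2 st en hr.
have S p q : p = q + n -> p = q %[mod n] by move=> ->; rewrite modnDr.
have Z p : x <= p < b -> excess k a b p = 0.
  move=> /andP[xp pb]; rewrite /excess [b <= p]leqNgt pb /=.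
  by rewrite (leq_trans ax xp).
case: (diagP core sums bE nE xe hr) => [rx|j i jg i3 rE|p hp rE|j i jg i3 rE].
- have rb : r < b by lia.
  by congr (_ %% _); rewrite -(st r rx) /excess [x <= r]leqNgt rx [b <= r]leqNgt rb.
- by congr (_ %% _); rewrite Z; move: i i3 rE => [|[|[|]]] //= _; lia.
- by apply: S; rewrite Z; have := en p hp; lia.
- have bi : (r - b) %% 3 = i by lia.
  apply: S; rewrite /excess bi (_ : b <= r); last by lia.
  by move: i i3 rE {bi} => [|[|[|]]] //= _; lia.
Qed.

(** Rows of Z_n are tight everywhere; a slab with base [m] has its top label in columns [m + 1],
    [m], [m + 2] of its three rows. *)
Lemma diag_tight k a x g b e n core r :
  a + 4 <= x -> b = 3 * g + e -> n = b + 3 * g -> x <= e ->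
  (forall p, p < x -> lab k a x p (nth 0 core p) = p + excess k a x p) ->
  r < n -> lab k a b r (diag x g b core r) = r + excess k a b r.
Proof.
move=> ax bE nE xe st hr.
have Z p c : x <= p < b -> lab k a b p c = p + excess k a b p.
  move=> /andP[xp pb]; rewrite /lab /excess [b <= p]leqNgt pb /=.
  by rewrite (leq_trans ax xp) addn0.
case: (diagP core [::] bE nE xe hr) => [rx|j i jg i3 rE|p hp rE|j i jg i3 rE].
- have rb : r < b by lia.
  by have := st r rx; rewrite /lab /excess [x <= r]leqNgt rx [b <= r]leqNgt rb.
- by apply: Z; lia.
- by apply: Z; lia.
have bi : (r - b) %% 3 = i by lia.
rewrite /lab /excess bi (_ : b <= r); last by lia.
have -> : r - i = b + 3 * j by lia.
rewrite rE; move: i i3 {rE bi} => [|[|[|]]] //= _; rewrite /slab.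
- by rewrite addn1 (gtn_eqF (ltnSn _)) eqxx /=; lia.
- by rewrite addn0 eqxx /=; lia.
- move: (b + 3 * j) => m; rewrite !ifN; [|lia..].
  by rewrite [m + 2 + m]addnAC addnn oddD odd_double /= /swap3 addn0.
Qed.

(* The tables [core] used in the theorem come from a computer search; [sums]
   lists the symbols of the chosen cells, in the range [2, e + 2). *)
Definition core_ok (k h : nat) (core sums : seq nat) : bool :=
  let a := k + 3 * h in let x := 7 + 2 * h in let e := 10 + 4 * h in
  [&& a + 4 <= x,
      [&& size core == e, uniq core, all (ltn^~ e) core
        & all (fun p => (nth 0 core p < x) == (p < x)) (iota 0 e)],
      [&& size sums == e, uniq sums & all (fun s => 2 <= s < e + 2) sums],
      all (fun p => nth 0 core p + (p + excess k a x p) == nth 0 sums p) (iota 0 x),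
      all (fun p => nth 0 core p + p == e + nth 0 sums p) (iota x (e - x))
    & all (fun p => lab k a x p (nth 0 core p) == p + excess k a x p) (iota 0 x)].

(** A finite check at order [10 + 4 * h] serves all [g]: each increment inserts one slab and three
    rows of Z_n. *)
Lemma core_square k h core sums g n : core_ok k h core sums -> n = 6 * g + 10 + 4 * h ->
  exists L : 'I_n -> 'I_n -> 'I_n,
    [/\ is_latin_square L, tau L < n ^ 2 &
        n ^ 2 <= tau L + (g + (4 * g + 10 + 4 * h) ^ 2 + g ^ 2)].
Proof.
case/and5P => ax /and4P[/eqP sc uc lc /all_iotaP st] /and3P[/eqP ss us rs] /all_iotaP s1.
case/andP => /all_iotaP s2 /all_iotaP tg nE.
set a := k + 3 * h in ax s1 tg; set x := 7 + 2 * h in ax st s1 s2 tg.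
set e := 10 + 4 * h in sc lc st ss rs s2.
have [b bE] : exists b, b = 3 * g + e by exists (3 * g + e).
have bn : n = b + 3 * g by lia.
have n0 : 0 < n by lia.
have xe : x <= e by lia.
have tight r : r < n -> lab k a b r (diag x g b core r) = r + excess k a b r.
  by apply: (diag_tight (e := e)) => // p px; apply/eqP/tg.
exists (shifted n0 (lab k a b)); split.
- apply: shifted_latin => [r c hr _|r c1 c2|r1 r2 c _ _ _].
  + by apply: (@lab_lt n k a b h g) => //; lia.
  + by apply: (@lab_row_inj n k a b g) => //; lia.
  + by apply: (@lab_col_inj k a b h) => //; lia.
- have dlt r : r < n -> diag x g b core r < n by apply: (diag_lt (e := e)).
  pose u (r : 'I_n) : 'I_n := Ordinal (dlt r (ltn_ord r)).
  apply: (@tau_lt _ _ (Ordinal n0) (u (Ordinal n0))).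
  apply: in_transversal_inj => r1 r2 /(congr1 val) /= H; apply: val_inj.
  + by apply: (diag_inj (e := e) bE bn xe sc uc _ lc _ _ H) => // p pe; exact: (eqP (st p _)).
  + move: H (ltn_ord r1) (ltn_ord r2) => /= + h1 h2; rewrite !tight //.
    have E r : r < n -> _ := @diag_sumE k a x g b e n core sums r ax bE bn xe _ _ _.
    rewrite !E //; try lia; try by move=> p hp; apply/eqP; (apply: s1 || apply: s2); lia.
    by apply: (diag_sum_inj (e := e)) => //; lia.
- have := @card_in_transversal k a b h g n n0; rewrite -(tau_add (shifted n0 (lab k a b))) leq_add2l.
  have -> : 4 * g + 10 + 4 * h = b + g by lia.
  by apply => //; lia.
Qed.

(* No square of the family above has order 12; Z_2 x Z_6 has a transversal. *)
Definition Z2Z6 (r c : nat) : nat := 6 * ((r %/ 6 + c %/ 6) %% 2) + (r + c) %% 6.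

Lemma square12 : exists L : 'I_12 -> 'I_12 -> 'I_12, is_latin_square L /\ tau L < 12 ^ 2.
Proof.
have lt r c : Z2Z6 r c < 12 by rewrite /Z2Z6; lia.
have cancel r c1 c2 : c1 < 12 -> c2 < 12 -> Z2Z6 r c1 = Z2Z6 r c2 -> c1 = c2.
  by rewrite /Z2Z6; lia.
have comm r c : Z2Z6 r c = Z2Z6 c r by rewrite /Z2Z6 [r %/ 6 + _]addnC [r + c]addnC.
exists (fun r c => Ordinal (lt r c)); split.
  split=> [r c1 c2|c r1 r2] /(congr1 val) /=; last rewrite ![Z2Z6 _ c]comm;
    by move/cancel => H; apply: val_inj; apply: H; rewrite /= ltn_ord.
pose t := [:: 0; 1; 2; 6; 7; 8; 4; 5; 9; 10; 11; 3].
have nth_inj (l : seq nat) x y : size l = 12 -> uniq l -> x < 12 -> y < 12 ->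
    nth 0 l x = nth 0 l y -> x = y.
  by move=> sl ul hx hy /eqP; rewrite nth_uniq ?sl // => /eqP.
have tlt x : x < 12 -> nth 0 t x < 12.
  by move=> hx; apply: (all_nthP 0 (isT : all (ltn^~ 12) t)).
have vE x : x < 12 -> Z2Z6 x (nth 0 t x) = nth 0 [seq Z2Z6 x (nth 0 t x) | x <- iota 0 12] x.
  by move=> hx; rewrite (nth_map 0) ?size_iota // nth_iota.
pose u (x : 'I_12) : 'I_12 := Ordinal (tlt x (ltn_ord x)).
apply: (@tau_lt _ _ ord0 (u ord0)); apply: in_transversal_inj => x y /(congr1 val) /= H;
  apply: val_inj; move: H.
  by apply: nth_inj; rewrite /= ?ltn_ord.
by rewrite !vE ?ltn_ord //; apply: nth_inj; rewrite ?ltn_ord ?size_map ?size_iota.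
Qed.

(* exists C, forall even n >= 10, exists latin L of order n with
   n^2 > tau L >= 19/36 n^2 - C n   (the lower bound multiplied by 36) *)
Theorem theorem2 :
  exists C : nat, forall n : nat, 10 <= n -> ~~ odd n ->
    exists L : 'I_n -> 'I_n -> 'I_n,
      is_latin_square L /\ tau L < n ^ 2 /\ 19 * n ^ 2 <= 36 * tau L + 36 * C * n.
Proof.
exists 100 => n n10 on.
have [->|n12] := eqVneq n 12.
  (* At order 12 the linear term alone exceeds [19 * n ^ 2]. *)
  by have [L [lL tL]] := square12; exists L; do 2!split=> //; lia.
have fam k h core sums g : core_ok k h core sums -> h < 3 -> n = 6 * g + 10 + 4 * h ->
    exists L : 'I_n -> 'I_n -> 'I_n,
      is_latin_square L /\ tau L < n ^ 2 /\ 19 * n ^ 2 <= 36 * tau L + 36 * 100 * n.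
  move=> ok h3 nE; have [L [lL tL low]] := core_square ok nE.
  exists L; do 2!split=> //; move: low; move: (tau L) => t.
  (* To leading order [n ^ 2] is [36 * g ^ 2] and the bound [17 * g ^ 2]; the constant 100 absorbs
     the lower terms. *)
  by rewrite nE -!mulnn; move: h h3 {ok nE} => [|[|[|]]] // _; nia.
(* The residues 4, 2, 0 modulo 6 take [h] = 0, 1, 2, starting at orders 10, 14, 18. *)
have [n4|n4] := eqVneq (n %% 6) 4.
  by apply: (fam 2 0 [:: 3; 1; 0; 5; 6; 2; 4; 7; 8; 9] [:: 3; 2; 5; 9; 11; 7; 10; 4; 6; 8]
    ((n - 10) %/ 6)) => //; lia.
have [n2|n2] := eqVneq (n %% 6) 2.
  by apply: (fam 0 1 [:: 1; 4; 0; 3; 2; 8; 5; 6; 7; 9; 10; 11; 12; 13]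
    [:: 3; 5; 2; 9; 7; 14; 11; 13; 15; 4; 6; 8; 10; 12] ((n - 14) %/ 6)) => //; lia.
by apply: (fam 0 2 [:: 1; 4; 0; 5; 2; 6; 3; 9; 10; 7; 8; 11; 14; 12; 13; 17; 15; 16]
  [:: 3; 5; 2; 10; 6; 11; 12; 17; 19; 16; 18; 4; 8; 7; 9; 14; 13; 15] ((n - 18) %/ 6)) => //; lia.
Qed.
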